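(* Let $\mathcal R\subseteq 2^{\mathbb N}$ be a class with the Join Property. Then for every real $A$ with $0'\leq_{\mathrm T}A$, the set of Turing degrees $$\mathcal F_{\mathcal R}(A)=\{\deg_{\mathrm T}(B): B\in\mathcal R\ \text{and}\ B'\equiv_{\mathrm T}B\oplus 0'\equiv_{\mathrm T}A\}$$ is countably infinite.
   Context: Reals are elements of Cantor space $2^{\mathbb N}$, identified with subsets of $\mathbb N$. $\leq_{\mathrm T},\equiv_{\mathrm T}$ denote Turing reducibility and equivalence; $\deg_{\mathrm T}(B)$ is the $\equiv_{\mathrm T}$-equivalence class of $B$; $Z>_{\mathrm T}0$ means that $Z$ is noncomputable. The join is $(X\oplus Y)(2n)=X(n)$, $(X\oplus Y)(2n+1)=Y(n)$; $X'$ is the Turing jump of $X$, and $0'=\varnothing'$. A class $\mathcal C\subseteq 2^{\mathbb N}$ (an arbitrary set of reals) has the Join Property if for all reals $A,Z$ with $Z\oplus 0'\leq_{\mathrm T}A$ and $Z>_{\mathrm T}0$ there is $B\in\mathcal C$ with $A\equiv_{\mathrm T}B'\equiv_{\mathrm T}B\oplus 0'\equiv_{\mathrm T}B\oplus Z$. *)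

(* Defs.v *)
From mathcomp Require Import all_boot.
From mathcomp Require Import boolp classical_sets cardinality.
From Stdlib Require Cantor.

Set Implicit Arguments.
Unset Strict Implicit.
Unset Printing Implicit Defensive.

Local Open Scope classical_set_scope.

Arguments Cantor.to_nat : simpl never.
Arguments Cantor.of_nat : simpl never.

Definition real : Type := nat -> bool.

(* Oracle programs, denoting partial functions from nat to nat; several
   arguments are passed through the Cantor pairing <x, y> = Cantor.to_nat (x, y).
   This is Kleene's definition of the functions partial recursive in an
   oracle. *)
Inductive code : Type :=
| Zero
| Succ
| Fst
| Snd
| Oracle
| Pair of code & code
| Comp of code & code
| Prec of code & code
| Mu of code.

(* Graph of h with h(a, 0) = f(a) and h(a, m + 1) = g(a, (m, h(a, m))). *)
Fixpoint prec_graph (f g : nat -> nat -> Prop) (a m y : nat) : Prop :=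
  match m with
  | 0 => f a y
  | k.+1 => exists z, prec_graph f g a k z /\
                      g (Cantor.to_nat (a, Cantor.to_nat (k, z))) y
  end.

(* [eval X c n y]: with oracle X, program c on input n halts with output y. *)
Fixpoint eval (X : real) (c : code) (n y : nat) {struct c} : Prop :=
  match c with
  | Zero => y = 0
  | Succ => y = n.+1
  | Fst => y = (Cantor.of_nat n).1
  | Snd => y = (Cantor.of_nat n).2
  | Oracle => y = X n
  | Pair f g => exists a b,
      [/\ eval X f n a, eval X g n b & y = Cantor.to_nat (a, b)]
  | Comp f g => exists a, eval X g n a /\ eval X f a y
  | Prec f g =>
      prec_graph (eval X f) (eval X g)
        (Cantor.of_nat n).1 (Cantor.of_nat n).2 y
  | Mu f =>
      eval X f (Cantor.to_nat (n, y)) 0 /\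
      forall k, k < y -> exists v, eval X f (Cantor.to_nat (n, k)) v.+1
  end.

Lemma prec_graph_fun (f g : nat -> nat -> Prop) :
  (forall n y z, f n y -> f n z -> y = z) ->
  (forall n y z, g n y -> g n z -> y = z) ->
  forall a m y z, prec_graph f g a m y -> prec_graph f g a m z -> y = z.
Proof.
move=> hf hg a; elim=> [|k IH] y z /=; first exact: hf.
move=> [u [hu huy]] [v [hv hvz]].
by move: hvz; rewrite -(IH _ _ hu hv); apply: hg.
Qed.

Lemma eval_fun (X : real) (c : code) (n y z : nat) :
  eval X c n y -> eval X c n z -> y = z.
Proof.
elim: c n y z => [|||||f IHf g IHg|f IHf g IHg|f IHf g IHg|f IHf] n y z /=;
  try by move=> -> ->.
- move=> [a [b [ha hb ->]]] [a' [b' [ha' hb' ->]]].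
  by rewrite (IHf _ _ _ ha ha') (IHg _ _ _ hb hb').
- move=> [a [ha hy]] [b [hb hz]].
  by move: hz; rewrite -(IHg _ _ _ ha hb); apply: IHf.
- exact: prec_graph_fun.
- move=> [hy ly] [hz lz]; case: (ltngtP y z) => // [yz|zy].
  + by have [v hv] := lz _ yz; have := IHf _ _ _ hy hv.
  + by have [v hv] := ly _ zy; have := IHf _ _ _ hz hv.
Qed.

(* The Goedel number of a program. *)
Fixpoint encode (c : code) : nat :=
  match c with
  | Zero => Cantor.to_nat (0, 0)
  | Succ => Cantor.to_nat (1, 0)
  | Fst => Cantor.to_nat (2, 0)
  | Snd => Cantor.to_nat (3, 0)
  | Oracle => Cantor.to_nat (4, 0)
  | Pair f g => Cantor.to_nat (5, Cantor.to_nat (encode f, encode g))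
  | Comp f g => Cantor.to_nat (6, Cantor.to_nat (encode f, encode g))
  | Prec f g => Cantor.to_nat (7, Cantor.to_nat (encode f, encode g))
  | Mu f => Cantor.to_nat (8, encode f)
  end.

Lemma encode_inj : injective encode.
Proof.
elim=> [|||||f IHf g IHg|f IHf g IHg|f IHf g IHg|f IHf]
  [|||||f' g'|f' g'|f' g'|f'] //= /(@Cantor.to_nat_inj (_, _) (_, _)) [] //.
- by move=> /(@Cantor.to_nat_inj (_, _) (_, _)) [/IHf -> /IHg ->].
- by move=> /(@Cantor.to_nat_inj (_, _) (_, _)) [/IHf -> /IHg ->].
- by move=> /(@Cantor.to_nat_inj (_, _) (_, _)) [/IHf -> /IHg ->].
- by move=> /IHf ->.
Qed.

(* Graph of the e-th partial X-computable function; it is nowhere defined when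
   e is not the number of a program. *)
Definition phi (X : real) (e n y : nat) : Prop :=
  exists c, encode c = e /\ eval X c n y.

Definition turing_le (Y X : real) : Prop :=
  exists e, forall n, phi X e n (Y n).

Definition turing_equiv (X Y : real) : Prop := turing_le X Y /\ turing_le Y X.

Definition empty_real : real := fun _ => false.

Definition computable (X : real) : Prop := turing_le X empty_real.

Definition join (X Y : real) : real :=
  fun n => if odd n then Y n./2 else X n./2.

Definition jump (X : real) : real := fun e => `[< exists y, phi X e e y >].

Definition deg (B : real) : set real := [set C | turing_equiv C B].

Definition join_property (C : set real) : Prop :=
  forall A Z : real,
    turing_le (join Z (jump empty_real)) A -> ~ computable Z ->
    exists B : real,
      [/\ C B, turing_equiv A (jump B),
          turing_equiv (jump B) (join B (jump empty_real)) &
          turing_equiv (join B (jump empty_real)) (join B Z)].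

Definition jump_degrees (R : set real) (A : real) : set (set real) :=
  [set deg B | B in
    [set B | [/\ R B, turing_equiv (jump B) (join B (jump empty_real)) &
                 turing_equiv (join B (jump empty_real)) A]]].

(* Main.v *)
Require Import Defs.
From mathcomp Require Import all_boot.
From mathcomp Require Import boolp classical_sets cardinality.
From Stdlib Require Cantor.

Set Implicit Arguments.
Unset Strict Implicit.
Unset Printing Implicit Defensive.

Local Open Scope classical_set_scope.
Local Open Scope card_scope.

(** Countability holds because each [B] in question is computable from
    [A], and a degree is determined by a program computing one of its members
    from [A].

    For infinity, suppose that [deg (B 0)], ..., [deg (B K.-1)] are all the
    degrees in question.  The Join Property turns any noncomputable [Z] below
    [A] into some [C] in [R] whose degree is in question and which satisfies
    [A <= C + Z], with [+] for the join; since [C] is equivalent to some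
    [B i], it follows that [A <= B i + Z].  So it is enough to find a
    noncomputable [Z] below [A] with [A] not below any [B i + Z]
    ([avoid_cones]).

    Such a [Z] comes from finite-extension forcing carried out computably in
    [A].  At a stage attached to a program number [e] and an index [i], with
    the string [s] built so far, the question is whether some longer string
    [t] extending [s] makes program [e] converge on input [e] with oracle
    [B i + t].  This is a Sigma_1 question about [B i], hence decided by the
    jump of [B i], hence by [A]; if the answer is yes, such a [t] becomes the
    next string.  The answer then says whether program [e] halts on [e] with
    oracle [B i + Z].
    - The answers are uniformly computable from [A].  If [A <= B i + Z], then
      [B i + Z] would decide its own halting problem, against [diagonal].
    - If [Z] were computable, consider the program which searches its oracle
      [B + W] for a place where [W] differs from [Z].  It diverges on
      [B 0 + Z], although every string can be extended so as to make it
      converge, and so the answer given at its stage was yes: a contradiction.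

    To make the question Sigma_1 uniformly in [e], convergence is expressed by
    the existence of a coded computation tree, a notion decidable in the
    oracle ([dec_converges_via]). *)

(** * Pairing *)

Definition pr (a b : nat) : nat := Cantor.to_nat (a, b).
Definition p1 (n : nat) : nat := (Cantor.of_nat n).1.
Definition p2 (n : nat) : nat := (Cantor.of_nat n).2.

Lemma p1_pr a b : p1 (pr a b) = a.
Proof. by rewrite /p1 /pr Cantor.cancel_of_to. Qed.

Lemma p2_pr a b : p2 (pr a b) = b.
Proof. by rewrite /p2 /pr Cantor.cancel_of_to. Qed.

Lemma pr_p n : pr (p1 n) (p2 n) = n.
Proof. by rewrite /pr /p1 /p2 -surjective_pairing Cantor.cancel_to_of. Qed.

Definition prE := (p1_pr, p2_pr).

Lemma leq_prl a b : a <= pr a b.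
Proof.
have /leP := Cantor.to_nat_non_decreasing a b.
by apply: leq_trans; rewrite plusE leq_addl.
Qed.

Lemma leq_prr a b : b <= pr a b.
Proof.
have /leP := Cantor.to_nat_non_decreasing a b.
by apply: leq_trans; rewrite plusE leq_addr.
Qed.

Arguments pr : simpl never.
Arguments p1 : simpl never.
Arguments p2 : simpl never.

(** * Functions and relations computable in an oracle *)

Definition recfun (X : real) (f : nat -> nat) : Prop :=
  exists c, forall n, eval X c n (f n).

Lemma turing_leE Y X : turing_le Y X <-> recfun X (fun n => Y n).
Proof.
split=> [[e he]|[c hc]].
- have [c [hce _]] := he 0; exists c => n.
  have [c' [hc' ev]] := he n.
  by move: hc'; rewrite -hce => /encode_inj <-.
- by exists (encode c) => n; exists c.
Qed.

Section Closure.
Variable X : real.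
Implicit Types f g : nat -> nat.

Lemma eq_recfun f g : f =1 g -> recfun X f -> recfun X g.
Proof. by move=> fg [c hc]; exists c => n; rewrite -fg. Qed.

Lemma rec_oracle f : recfun X f -> recfun X (fun n => X (f n)).
Proof. by move=> [c hc]; exists (Comp Oracle c) => n; exists (f n). Qed.

Lemma rec_succ f : recfun X f -> recfun X (fun n => (f n).+1).
Proof. by move=> [c hc]; exists (Comp Succ c) => n; exists (f n). Qed.

Lemma rec_p1 f : recfun X f -> recfun X (fun n => p1 (f n)).
Proof. by move=> [c hc]; exists (Comp Fst c) => n; exists (f n). Qed.

Lemma rec_p2 f : recfun X f -> recfun X (fun n => p2 (f n)).
Proof. by move=> [c hc]; exists (Comp Snd c) => n; exists (f n). Qed.

Lemma rec_pr f g :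
  recfun X f -> recfun X g -> recfun X (fun n => pr (f n) (g n)).
Proof.
by move=> [c hc] [d hd]; exists (Pair c d) => n; exists (f n), (g n).
Qed.

Lemma rec_comp f g : recfun X f -> recfun X g -> recfun X (fun n => f (g n)).
Proof. by move=> [c hc] [d hd]; exists (Comp c d) => n; exists (g n). Qed.

Lemma rec_id : recfun X (fun n => n).
Proof.
exists (Pair Fst Snd) => n; exists (p1 n), (p2 n); split=> //.
by rewrite -[LHS]pr_p.
Qed.

Fixpoint const_code (a : nat) : code :=
  if a is b.+1 then Comp Succ (const_code b) else Zero.

Lemma eval_const a n : eval X (const_code a) n a.
Proof. by elim: a => [|a IH] //=; exists a. Qed.

Lemma rec_const a : recfun X (fun=> a).
Proof. by exists (const_code a) => n; apply: eval_const. Qed.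

(** The functions [f], [m] and [G] all receive the same number [n], which plays
    the part of an environment.  The same convention is used for every binder
    below: the body is computed from the pair of the environment and the value
    of the bound variable. *)
Lemma rec_natrec f m (G : nat -> nat -> nat -> nat) :
  recfun X f -> recfun X m ->
  recfun X (fun n => G (p1 n) (p1 (p2 n)) (p2 (p2 n))) ->
  recfun X (fun n => nat_rect (fun=> nat) (f n) (G n) (m n)).
Proof.
move=> [cf hf] [cm hm] [cg hg]; have [ci hi] := rec_id.
exists (Comp (Prec cf cg) (Pair ci cm)) => n.
exists (pr n (m n)); split; first by exists n, (m n).
change (prec_graph (eval X cf) (eval X cg) (p1 (pr n (m n))) (p2 (pr n (m n)))
  (nat_rect (fun=> nat) (f n) (G n) (m n))).
rewrite !prE; elim: (m n) => [|k IH] //=.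
eexists; split; first exact: IH.
by have := hg (pr n (pr k (nat_rect (fun=> nat) (f n) (G n) k))); rewrite !prE.
Qed.

Lemma rec_pred f : recfun X f -> recfun X (fun n => (f n).-1).
Proof.
move=> hf.
apply: (@eq_recfun (fun n => nat_rect (fun=> nat) 0 (fun k _ => k) (f n))).
  by move=> n; case: (f n).
by apply: rec_natrec => //; [apply: rec_const | apply/rec_p1/rec_p2/rec_id].
Qed.

Lemma rec_add f g :
  recfun X f -> recfun X g -> recfun X (fun n => f n + g n).
Proof.
move=> hf hg.
apply: (@eq_recfun (fun n => nat_rect (fun=> nat) (f n) (fun _ z => z.+1) (g n))).
  by move=> n; elim: (g n) => [|k /= ->]; rewrite ?addn0 ?addnS.
by apply: rec_natrec => //; apply/rec_succ/rec_p2/rec_p2/rec_id.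
Qed.

Lemma rec_sub f g :
  recfun X f -> recfun X g -> recfun X (fun n => f n - g n).
Proof.
move=> hf hg.
apply: (@eq_recfun (fun n => nat_rect (fun=> nat) (f n) (fun _ z => z.-1) (g n))).
  by move=> n; elim: (g n) => [|k /= ->]; rewrite ?subn0 ?subnS.
by apply: rec_natrec => //; apply/rec_pred/rec_p2/rec_p2/rec_id.
Qed.

(** Zero stands for truth, so that bounded universal quantification becomes a
    sum and search becomes the operator [Mu]. *)
Definition dec (P : nat -> Prop) : Prop :=
  exists2 f, recfun X f & forall n, P n <-> f n = 0.

Lemma eq_dec (P Q : nat -> Prop) : (forall n, P n <-> Q n) -> dec P -> dec Q.
Proof. by move=> PQ [f rf hf]; exists f => // n; rewrite -PQ. Qed.

Lemma dec_comp P f : dec P -> recfun X f -> dec (fun n => P (f n)).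
Proof. by move=> [g rg hg] rf; exists (fun n => g (f n)) => //; apply: rec_comp. Qed.

Lemma dec_leq f g : recfun X f -> recfun X g -> dec (fun n => f n <= g n).
Proof.
move=> rf rg; exists (fun n => f n - g n); first exact: rec_sub.
by move=> n; split=> [|/eqP] //; rewrite -subn_eq0 => /eqP.
Qed.

Lemma dec_and P Q : dec P -> dec Q -> dec (fun n => P n /\ Q n).
Proof.
move=> [f rf hf] [g rg hg]; exists (fun n => f n + g n); first exact: rec_add.
move=> n; rewrite hf hg; split=> [[-> ->] //|/eqP].
by rewrite addn_eq0 => /andP[/eqP -> /eqP ->].
Qed.

Lemma dec_not P : dec P -> dec (fun n => ~ P n).
Proof.
move=> [f rf hf]; exists (fun n => 1 - f n).
  by apply: rec_sub => //; apply: rec_const.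
by move=> n; rewrite hf; case: (f n) => [|k]; split.
Qed.

Lemma dec_or P Q : dec P -> dec Q -> dec (fun n => P n \/ Q n).
Proof.
move=> dP dQ.
apply: (@eq_dec (fun n => ~ (~ P n /\ ~ Q n))).
  by move=> n; rewrite -not_orP notK.
by apply/dec_not/dec_and; apply: dec_not.
Qed.

Lemma dec_imp P Q : dec P -> dec Q -> dec (fun n => P n -> Q n).
Proof.
move=> dP dQ; apply: (@eq_dec (fun n => ~ P n \/ Q n)).
  by move=> n; rewrite implyE.
by apply: dec_or => //; apply: dec_not.
Qed.

Lemma dec_eq f g : recfun X f -> recfun X g -> dec (fun n => f n = g n).
Proof.
move=> rf rg; apply: (@eq_dec (fun n => f n <= g n /\ g n <= f n)).
  move=> n; split=> [[h1 h2]|->] //.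
  by apply/eqP; rewrite eqn_leq h1.
by apply: dec_and; apply: dec_leq.
Qed.

Lemma dec_eqb f g : recfun X f -> recfun X g -> dec (fun n => f n == g n).
Proof.
move=> rf rg; apply: (@eq_dec (fun n => f n = g n)); last exact: dec_eq.
by move=> n; split=> /eqP.
Qed.

Lemma dec_if (b : nat -> bool) P Q : dec (fun n => b n) -> dec P -> dec Q ->
  dec (fun n => if b n then P n else Q n).
Proof.
move=> db dP dQ.
apply: (@eq_dec (fun n => (b n /\ P n) \/ (~ b n /\ Q n))).
  move=> n; case: (b n); split.
  - by case=> [[]|[]].
  - by left.
  - by case=> [[]|[]].
  - by right.
by apply: dec_or; apply: dec_and => //; apply: dec_not.
Qed.

Lemma rec_bool (b : nat -> bool) :
  dec (fun n => b n) -> recfun X (fun n => b n).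
Proof.
move=> [f rf hf]; apply: (@eq_recfun (fun n => 1 - f n)); last first.
  by apply: rec_sub => //; apply: rec_const.
move=> n; have := hf n; case: (b n); case: (f n) => [|k] [h1 h2] //.
- by have := h1 isT.
- by have := h2 erefl.
Qed.

Lemma dec_oracle f : recfun X f -> dec (fun n => X (f n)).
Proof.
move=> rf; exists (fun n => 1 - X (f n)).
  by apply: rec_sub; [apply: rec_const | apply: rec_oracle].
by move=> n; case: (X (f n)); split.
Qed.

Lemma dec_ball (P : nat -> nat -> Prop) m :
  recfun X m -> dec (fun n => P (p1 n) (p2 n)) ->
  dec (fun n => forall k, k < m n -> P n k).
Proof.
move=> rm [f rf hf].
exists (fun n => nat_rect (fun=> nat) 0 (fun k z => z + f (pr n k)) (m n)).
  apply: rec_natrec => //; first exact: rec_const.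
  apply: rec_add; first by apply/rec_p2/rec_p2/rec_id.
  apply: rec_comp => //; apply: rec_pr; first by apply/rec_p1/rec_id.
  by apply/rec_p1/rec_p2/rec_id.
move=> n; elim: (m n) => [|k IH] /=; first by split.
split=> [h|/eqP].
  have -> : f (pr n k) = 0 by apply/hf; rewrite !prE; apply: h.
  by rewrite addn0; apply/IH => j jk; apply: h; apply: ltnW.
rewrite addn_eq0 => /andP[/eqP /IH h /eqP hk] j.
rewrite ltnS leq_eqVlt => /orP[/eqP ->|]; last exact: h.
by have /hf := hk; rewrite !prE.
Qed.

Lemma dec_bex (P : nat -> nat -> Prop) m :
  recfun X m -> dec (fun n => P (p1 n) (p2 n)) ->
  (forall n k, P n k -> k < m n) ->
  dec (fun n => exists k, P n k).
Proof.
move=> rm dP bd.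
apply: (@eq_dec (fun n => ~ forall k, k < m n -> ~ P n k)).
  move=> n; split=> [/existsNP[k /not_implyP[_ /contrapT Pk]]|[k Pk] h].
    by exists k.
  by apply: (h k) => //; apply: bd Pk.
by apply/dec_not/dec_ball => //; apply: dec_not.
Qed.

(** The outer quantifier has a fixed bound, so the decision procedures of the
    [P i] need not be uniform in [i]. *)
Lemma dec_ball_fin (P : nat -> nat -> Prop) m :
  (forall i, i < m -> dec (P i)) -> dec (fun n => forall i, i < m -> P i n).
Proof.
elim: m => [|m IH] h.
  by exists (fun=> 0); [apply: rec_const | move=> n; split].
apply: (@eq_dec (fun n => (forall i, i < m -> P i n) /\ P m n)).
  move=> n; split=> [[h1 h2] i|h'].
    by rewrite ltnS leq_eqVlt => /orP[/eqP -> //|]; apply: h1.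
  by split=> [i im|]; apply: h'; rewrite ltnS // ltnW.
by apply: dec_and; [apply: IH => i im; apply: h; apply: ltnW | apply: h].
Qed.

Lemma dec_search (P : nat -> nat -> Prop) :
  dec (fun n => P (p1 n) (p2 n)) ->
  exists c, forall n, (exists y, eval X c n y) <-> exists k, P n k.
Proof.
move=> [f [c hc] hf]; exists (Mu c) => n; split=> [[y [hy _]]|[k Pk]].
  exists y; have := (hf (pr n y)).2; rewrite !prE; apply.
  by rewrite (eval_fun (hc _) hy).
have ex : exists j, f (pr n j) == 0.
  by exists k; apply/eqP/hf; rewrite !prE.
exists (ex_minn ex); case: ex_minnP => j /eqP hj jmin /=; split.
  by have := hc (pr n j); rewrite hj.
move=> i ij; exists (f (pr n i)).-1; rewrite prednK ?lt0n; first exact: hc.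
by apply/negP => /jmin; rewrite leqNgt ij.
Qed.

Lemma rec_choice (P : nat -> nat -> Prop) :
  (forall n, exists k, P n k) -> dec (fun n => P (p1 n) (p2 n)) ->
  exists2 f, recfun X f & forall n, P n (f n).
Proof.
move=> ex [f [c hc] hf].
have ex' n : exists j, f (pr n j) == 0.
  by have [k Pk] := ex n; exists k; apply/eqP/hf; rewrite !prE.
exists (fun n => ex_minn (ex' n)).
  exists (Mu c) => n; case: ex_minnP => j /eqP hj jmin /=; split.
    by have := hc (pr n j); rewrite hj.
  move=> i ij; exists (f (pr n i)).-1; rewrite prednK ?lt0n; first exact: hc.
  by apply/negP => /jmin; rewrite leqNgt ij.
move=> n; case: ex_minnP => j /eqP /hf; by rewrite !prE.
Qed.

(** The number [pr a0 (pr a1 (pr a2 d))] codes lists beginning with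
    [a0; a1; a2]; the length is kept separately. *)
Definition nthc (d i : nat) : nat := p1 (nat_rect (fun=> nat) d (fun=> p2) i).

Lemma rec_nthc f g :
  recfun X f -> recfun X g -> recfun X (fun n => nthc (f n) (g n)).
Proof.
move=> rf rg; apply: rec_p1; apply: rec_natrec => //.
by apply/rec_p2/rec_p2/rec_p2/rec_id.
Qed.

Lemma dec_odd f : recfun X f -> dec (fun n => odd (f n)).
Proof.
move=> rf; exists (fun n => nat_rect (fun=> nat) 1 (fun _ z => 1 - z) (f n)).
  apply: rec_natrec => //; first exact: rec_const.
  by apply: rec_sub; [apply: rec_const | apply/rec_p2/rec_p2/rec_id].
move=> n; suff -> : nat_rect (fun=> nat) 1 (fun _ z => 1 - z) (f n) = ~~ odd (f n).
  by case: odd; split.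
by elim: (f n) => [|k /= ->] //; case: odd.
Qed.

Lemma rec_half f : recfun X f -> recfun X (fun n => (f n)./2).
Proof.
move=> rf.
apply: (@eq_recfun (fun n =>
  nat_rect (fun=> nat) 0 (fun k z => odd k + z) (f n))).
  by move=> n; elim: (f n) => [|k /= ->] //; rewrite uphalf_half.
apply: rec_natrec => //; first exact: rec_const.
apply: rec_add; last by apply/rec_p2/rec_p2/rec_id.
by apply/rec_bool/dec_odd/rec_p1/rec_p2/rec_id.
Qed.

End Closure.

Ltac rec_auto := repeat first
  [ eassumption | apply: rec_const | apply: rec_id | apply: rec_succ
  | apply: rec_nthc | apply: rec_half | apply: rec_p1 | apply: rec_p2
  | apply: rec_pr | apply: rec_pred | apply: rec_add | apply: rec_sub
  | apply: dec_odd | apply: dec_eqb | apply: dec_eq | apply: dec_leq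
  | apply: dec_and | apply: dec_or | apply: dec_if | apply: dec_imp
  | apply: dec_not | apply: rec_bool ].

Arguments nthc : simpl never.

(** * Turing reducibility *)

Fixpoint subst_oracle (s : code) (c : code) : code :=
  match c with
  | Oracle => s
  | Pair f g => Pair (subst_oracle s f) (subst_oracle s g)
  | Comp f g => Comp (subst_oracle s f) (subst_oracle s g)
  | Prec f g => Prec (subst_oracle s f) (subst_oracle s g)
  | Mu f => Mu (subst_oracle s f)
  | c => c
  end.

Lemma eval_subst (X Y : real) s c n y :
  (forall m, eval Y s m (X m)) ->
  eval X c n y -> eval Y (subst_oracle s c) n y.
Proof.
move=> hs.
elim: c n y => [|||||f IHf g IHg|f IHf g IHg|f IHf g IHg|f IHf] n y //=.
- by move=> ->.
- by move=> [a [b [/IHf ha /IHg hb ->]]]; exists a, b.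
- by move=> [a [/IHg ha /IHf hb]]; exists a.
- elim: (_.2) y => [|k IH] y /=; first exact: IHf.
  by move=> [z [/IH hz /IHg hy]]; exists z.
- move=> [/IHf hy lt]; split=> // k /lt[v /IHf hv]; by exists v.
Qed.

Lemma recfun_trans X Y f : turing_le X Y -> recfun X f -> recfun Y f.
Proof.
move=> /turing_leE[s hs] [c hc]; exists (subst_oracle s c) => n.
exact: eval_subst (hc n).
Qed.

Lemma dec_trans X Y P : turing_le X Y -> dec X P -> dec Y P.
Proof. by move=> XY [f rf hf]; exists f => //; apply: recfun_trans XY rf. Qed.

Lemma turing_le_trans X Y Z : turing_le X Y -> turing_le Y Z -> turing_le X Z.
Proof. by move=> /turing_leE XY YZ; apply/turing_leE/(recfun_trans YZ). Qed.

Lemma turing_le_refl X : turing_le X X.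
Proof. by apply/turing_leE/rec_oracle/rec_id. Qed.

(** A program that uses only the empty oracle can be made to ignore its
    oracle. *)
Lemma uniform_recfun f :
  recfun empty_real f -> exists c, forall X n, eval X c n (f n).
Proof.
move=> [c hc]; exists (subst_oracle Zero c) => X n.
by apply: (eval_subst _ (hc n)).
Qed.

Lemma join_lub X Y A : turing_le X A -> turing_le Y A -> turing_le (join X Y) A.
Proof.
move=> /turing_leE rX /turing_leE rY; apply/turing_leE/rec_bool.
apply: (eq_dec (P := fun n =>
  if odd n then nat_of_bool (Y n./2) = 1 else nat_of_bool (X n./2) = 1)).
  by move=> n; rewrite /join; case: ifP => _; case: (_ n./2); split.
apply: dec_if; first by apply: dec_odd; apply: rec_id.
- by apply: dec_eq; [apply: (rec_comp rY) | ]; rec_auto.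
- by apply: dec_eq; [apply: (rec_comp rX) | ]; rec_auto.
Qed.

Lemma join_ubl X Y : turing_le X (join X Y).
Proof.
apply/turing_leE/(eq_recfun (f := fun n => join X Y (n + n))).
  by move=> n; rewrite /join oddD addbb addnn doubleK.
by apply: rec_oracle; rec_auto.
Qed.

Lemma join_ubr X Y : turing_le Y (join X Y).
Proof.
apply/turing_leE/(eq_recfun (f := fun n => join X Y (n + n).+1)).
  move=> n; rewrite /join /= oddD addbb /= addnn uphalf_half odd_double /=.
  by rewrite doubleK.
by apply: rec_oracle; rec_auto.
Qed.

(** * Computation trees *)

Section Derivations.
Implicit Types (O : nat -> nat -> Prop) (G : nat -> nat -> nat -> Prop).

(** One step of the evaluation of programs, given by their numbers: [G e n y]
    supplies the values of shorter computations, and [O] is the graph of a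
    possibly partial oracle.  Numbers that code no program are not excluded;
    they are harmless because they never occur inside a computation of a
    genuine program. *)
Definition rule O G (e n y : nat) : Prop :=
  if p1 e == 0 then y = 0
  else if p1 e == 1 then y = n.+1
  else if p1 e == 2 then y = p1 n
  else if p1 e == 3 then y = p2 n
  else if p1 e == 4 then O n y
  else if p1 e == 5 then
    G (p1 (p2 e)) n (p1 y) /\ G (p2 (p2 e)) n (p2 y)
  else if p1 e == 6 then
    exists a, G (p2 (p2 e)) n a /\ G (p1 (p2 e)) a y
  else if p1 e == 7 then
    if p2 n == 0 then G (p1 (p2 e)) (p1 n) y
    else exists z, G e (pr (p1 n) (p2 n).-1) z /\
                   G (p2 (p2 e)) (pr (p1 n) (pr (p2 n).-1 z)) y
  else G (p2 e) (pr n y) 0 /\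
       forall k, k < y -> exists v, G (p2 e) (pr n k) v.+1.

(** Only the oracle query made by this very step matters, which is what yields
    the use principle [deriv_use]. *)
Lemma rule_mono O O' G G' e n y :
  (O n y -> O' n y) -> (forall e n y, G e n y -> G' e n y) ->
  rule O G e n y -> rule O' G' e n y.
Proof.
move=> hO hG; rewrite /rule.
repeat case: ifP => _ //.
- by move=> [/hG h1 /hG h2].
- by move=> [a [/hG h1 /hG h2]]; exists a.
- exact: hG.
- by move=> [z [/hG h1 /hG h2]]; exists z.
- move=> [/hG h1 h2]; split=> // k /h2[v /hG hv]; by exists v.
Qed.

Definition triple (e n y : nat) : nat := pr e (pr n y).

(** A computation tree flattened into a list: each triple follows by a rule
    from triples further down the list. *)
Fixpoint deriv O (s : seq nat) : Prop :=
  if s is t :: s' then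
    rule O (fun e n y => triple e n y \in s') (p1 t) (p1 (p2 t)) (p2 (p2 t))
    /\ deriv O s'
  else True.

Definition derivable O e n y : Prop :=
  exists s, deriv O s /\ triple e n y \in s.

Lemma deriv_cat O s1 s2 : deriv O s1 -> deriv O s2 -> deriv O (s1 ++ s2).
Proof.
move=> + d2; elim: s1 => [|t s1 IH] //= [h /IH]; split=> //.
by apply: rule_mono h => // e n y; rewrite mem_cat => ->.
Qed.

Lemma deriv_mono O O' s :
  (forall n y, O n y -> O' n y) -> deriv O s -> deriv O' s.
Proof.
move=> hO; elim: s => [|t s IH] //= [h /IH]; split=> //.
by apply: rule_mono h => // ?; apply: hO.
Qed.

(** Use principle: a computation consults finitely many oracle values. *)
Lemma deriv_use O s : deriv O s ->
  exists u, deriv (fun n y => n < u /\ O n y) s.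
Proof.
elim: s => [|t s IH] /=; first by exists 0.
move=> [h /IH[u hu]]; exists (maxn u (p1 (p2 t)).+1); split.
  by apply: rule_mono h => // ?; split=> //; rewrite leq_max ltnSn orbT.
apply: deriv_mono hu => n y [nu ?]; split=> //.
by rewrite leq_max nu.
Qed.

Lemma derivable_ball O f n (y : nat -> nat) m :
  (forall k, k < m -> derivable O f (n k) (y k)) ->
  exists s, deriv O s /\ forall k, k < m -> triple f (n k) (y k) \in s.
Proof.
elim: m => [|m IH] h; first by exists [::].
have [s1 [d1 h1]] := h m (ltnSn m).
have [s [ds hs]] := IH (fun k km => h k (ltnW km)).
exists (s1 ++ s); split; first exact: deriv_cat.
move=> k; rewrite mem_cat ltnS leq_eqVlt => /orP[/eqP ->|/hs ->].
  by rewrite h1.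
by rewrite orbT.
Qed.

Lemma derivable_step O s e n y : deriv O s ->
  rule O (fun e n y => triple e n y \in s) e n y -> derivable O e n y.
Proof.
move=> ds h; exists (triple e n y :: s); split; last exact: mem_head.
by rewrite /= /triple !prE.
Qed.

(** [derivable O] is closed under the rules, and [derivable_ind] says that it is
    the least such relation.  Since a rule has finitely many premises, their
    derivations can be concatenated. *)
Lemma derivable_rule O e n y : rule O (derivable O) e n y -> derivable O e n y.
Proof.
have step s := @derivable_step O s e n y.
rewrite {1}/rule; rewrite {1}/rule in step.
have two s1 s2 e1 n1 y1 e2 n2 y2 : deriv O s1 -> deriv O s2 ->
    triple e1 n1 y1 \in s1 -> triple e2 n2 y2 \in s2 ->
    exists s, [/\ deriv O s, triple e1 n1 y1 \in s & triple e2 n2 y2 \in s].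
  move=> d1 d2 h1 h2; exists (s1 ++ s2).
  by split; rewrite ?mem_cat ?h1 ?h2 ?orbT //; apply: deriv_cat.
case: ifP step => _ step; first exact: (step [::]).
case: ifP step => _ step; first exact: (step [::]).
case: ifP step => _ step; first exact: (step [::]).
case: ifP step => _ step; first exact: (step [::]).
case: ifP step => _ step; first exact: (step [::]).
case: ifP step => _ step.
  move=> [[s1 [d1 h1]] [s2 [d2 h2]]].
  by have [s [ds ? ?]] := two _ _ _ _ _ _ _ _ d1 d2 h1 h2; apply: (step s).
case: ifP step => _ step.
  move=> [a [[s1 [d1 h1]] [s2 [d2 h2]]]].
  have [s [ds ? ?]] := two _ _ _ _ _ _ _ _ d1 d2 h1 h2.
  by apply: (step s) => //; exists a.
case: ifP step => _; first case: ifP => _ step.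
- by move=> [s [ds h]]; apply: (step s).
- move=> [a [[s1 [d1 h1]] [s2 [d2 h2]]]].
  have [s [ds ? ?]] := two _ _ _ _ _ _ _ _ d1 d2 h1 h2.
  by apply: (step s) => //; exists a.
- move=> step [[s1 [d1 h1]] h].
  have /choice[v hv] : forall k, exists v,
      k < y -> derivable O (p2 e) (pr n k) v.+1.
    by move=> k; case: (boolP (k < y)) => [/h[v hv]|_]; [exists v | exists 0].
  have [s2 [d2 h2]] := derivable_ball (y := fun k => (v k).+1) hv.
  apply: (step (s1 ++ s2)); first exact: deriv_cat.
  split; first by rewrite mem_cat h1.
  by move=> k ky; exists (v k); rewrite mem_cat h2 ?orbT.
Qed.

Lemma derivable_ind O G :
  (forall e n y, rule O G e n y -> G e n y) ->
  forall e n y, derivable O e n y -> G e n y.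
Proof.
move=> hG e n y [s [ds]]; elim: s ds e n y => [|t s IH] //= [h /IH {}IH] e n y.
rewrite inE => /orP[/eqP E|]; last exact: IH.
apply: hG; move: h; rewrite -E /triple !prE => h.
by apply: rule_mono h => // ?; apply: IH.
Qed.

Lemma derivable_mono O O' e n y :
  (forall n y, O n y -> O' n y) -> derivable O e n y -> derivable O' e n y.
Proof. by move=> hO [s [/(deriv_mono hO) ds h]]; exists s. Qed.

Definition total_oracle (X : real) (n y : nat) : Prop := y = X n.

(** The definition of [encode], folded into [pr] so that the projection lemmas
    apply. *)
Lemma encodeE c : encode c = match c with
  | Zero => pr 0 0 | Succ => pr 1 0 | Fst => pr 2 0 | Snd => pr 3 0
  | Oracle => pr 4 0
  | Pair f g => pr 5 (pr (encode f) (encode g))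
  | Comp f g => pr 6 (pr (encode f) (encode g))
  | Prec f g => pr 7 (pr (encode f) (encode g))
  | Mu f => pr 8 (encode f) end.
Proof. by case: c. Qed.

Lemma eval_derivable X c n y :
  eval X c n y -> derivable (total_oracle X) (encode c) n y.
Proof.
elim: c n y => [|||||f IHf g IHg|f IHf g IHg|f IHf g IHg|f IHf] n y;
  rewrite encodeE => h; apply: derivable_rule; rewrite /rule !prE //=.
- by case: h => a [b [/IHf ha /IHg hb ->]]; rewrite -/(pr _ _) !prE.
- by case: h => a [/IHg ha /IHf hb]; exists a.
- move: h; rewrite /= -[in p2 n == 0](pr_p n) p2_pr.
  rewrite -/(p1 n) -/(p2 n).
  case: (p2 n) y => [|m] y /=; first exact: IHf.
  move=> [z [hz /IHg hy]]; exists z; split=> //.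
  elim: m z hz {hy y} => [|m IHm] z hz; apply: derivable_rule; rewrite /rule !prE /=.
    exact: IHf.
  by case: hz => u [/IHm hu /IHg hy]; exists u.
- case: h => /IHf h0 h; split=> // k /h[v /IHf]; by exists v.
Qed.

Lemma derivable_eval X c n y :
  derivable (total_oracle X) (encode c) n y -> eval X c n y.
Proof.
pose G e n y := forall c, encode c = e -> eval X c n y.
move=> h; suff : G (encode c) n y by apply.
move: h; apply: derivable_ind => {c n y} e n y + c E; rewrite -{}E.
case: c => [|||||f g|f g|f g|f]; rewrite encodeE /rule !prE //=.
- move=> [h1 h2]; exists (p1 y), (p2 y).
  by split; [apply: h1 | apply: h2 | rewrite -[LHS]pr_p].
- by move=> [a [h1 h2]]; exists a; split; [apply: h1 | apply: h2].
- rewrite -/(p1 n) -/(p2 n); case: (p2 n) => [|m] /=; first by apply.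
  move=> [z [h1 h2]]; exists z; split; last exact: h2.
  by have := h1 (Prec f g) erefl; rewrite /= -/(p1 _) -/(p2 _) !prE.
- move=> [h1 h2]; split; first exact: h1.
  by move=> k /h2[v hv]; exists v; apply: hv.
Qed.

End Derivations.

(** * Decidability of computation trees *)

Lemma nthc0 a d : nthc (pr a d) 0 = a.
Proof. by rewrite /nthc /= p1_pr. Qed.

Lemma nthcS a d i : nthc (pr a d) i.+1 = nthc d i.
Proof.
rewrite /nthc; congr p1; elim: i => [|i IH]; first by rewrite /= p2_pr.
by rewrite /= -IH.
Qed.

Lemma nthc_leq d i : nthc d i <= d.
Proof.
have le1 n : p1 n <= n by rewrite -{2}(pr_p n) leq_prl.
have le2 n : p2 n <= n by rewrite -{2}(pr_p n) leq_prr.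
apply: leq_trans (le1 _) _.
by elim: i => [|i IH] //=; apply: leq_trans (le2 _) IH.
Qed.

Lemma nthc_surj (f : nat -> nat) m :
  exists d, forall i, i < m -> nthc d i = f i.
Proof.
elim: m f => [|m IH] f; first by exists 0.
have [d hd] := IH (fun i => f i.+1); exists (pr (f 0) d) => -[|i] im.
  by rewrite nthc0.
by rewrite nthcS hd.
Qed.

Definition listc (d m : nat) : seq nat := mkseq (nthc d) m.

Lemma listc_surj s : exists d, listc d (size s) = s.
Proof.
have [d hd] := nthc_surj (nth 0 s) (size s); exists d.
rewrite -[RHS](mkseq_nth 0); apply/eq_in_map => i.
by rewrite mem_iota => /hd.
Qed.

Lemma deriv_iota O d a m :
  deriv O [seq nthc d i | i <- iota a m] <->
  forall i, a <= i -> i < a + m ->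
    rule O
      (fun e n y => exists j, (i < j /\ j < a + m) /\ nthc d j = triple e n y)
      (p1 (nthc d i)) (p1 (p2 (nthc d i))) (p2 (p2 (nthc d i))).
Proof.
elim: m a => [|m IH] a /=.
  by split=> // _ i ai; rewrite addn0 ltnNge ai.
have memE i e n y : triple e n y \in [seq nthc d i | i <- iota i.+1 m] <->
    exists j, (i < j /\ j < i.+1 + m) /\ nthc d j = triple e n y.
  split=> [/mapP[j]|[j [[ij jm] <-]]].
    by rewrite mem_iota => /andP[ij jm] ->; exists j.
  by apply: map_f; rewrite mem_iota ij.
have E1 : a + m.+1 = a.+1 + m by rewrite addnS.
rewrite {}E1 IH; split=> [[h1 h2] i|h].
  rewrite leq_eqVlt => /orP[/eqP <- _|]; last exact: h2.
  by apply: rule_mono h1 => // e n y /memE.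
split; last by move=> i ai; apply: h; apply: ltnW.
by apply: rule_mono (h a (leqnn _) _) => [|e n y /memE|] //; rewrite leq_addr.
Qed.

Lemma deriv_listc O d m :
  deriv O (listc d m) <->
  forall i, i < m ->
    rule O (fun e n y => exists j, (i < j /\ j < m) /\ nthc d j = triple e n y)
      (p1 (nthc d i)) (p1 (p2 (nthc d i))) (p2 (p2 (nthc d i))).
Proof.
rewrite /listc /mkseq deriv_iota.
by split=> h i; [apply: h | move=> _; apply: h].
Qed.

(** The unbounded quantifiers of [rule] range over values [y] occurring in
    [G x e n y], so any computable bound [b] for these makes them bounded. *)
Lemma dec_rule X (O : nat -> nat -> nat -> Prop)
    (G : nat -> nat -> nat -> nat -> Prop) (e n y b : nat -> nat) :
  recfun X e -> recfun X n -> recfun X y -> recfun X b ->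
  dec X (fun x => O (p1 x) (p1 (p2 x)) (p2 (p2 x))) ->
  dec X (fun x => G (p1 x) (p1 (p2 x)) (p1 (p2 (p2 x))) (p2 (p2 (p2 x)))) ->
  (forall x e n y, G x e n y -> y < b x) ->
  dec X (fun x => rule (O x) (G x) (e x) (n x) (y x)).
Proof.
move=> re rn ry rb dO dG bd.
have cO (x u v : nat -> nat) : recfun X x -> recfun X u -> recfun X v ->
    dec X (fun z => O (x z) (u z) (v z)).
  move=> rx ru rv.
  apply: eq_dec (dec_comp dO (rec_pr rx (rec_pr ru rv))) => z.
  by rewrite !prE.
have cG (x u v w : nat -> nat) : recfun X x -> recfun X u -> recfun X v ->
    recfun X w -> dec X (fun z => G (x z) (u z) (v z) (w z)).
  move=> rx ru rv rw.
  apply: eq_dec (dec_comp dG (rec_pr rx (rec_pr ru (rec_pr rv rw)))) => z.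
  by rewrite !prE.
have r1 : recfun X (fun x => e (p1 x)) by apply: rec_comp; rec_auto.
have r2 : recfun X (fun x => n (p1 x)) by apply: rec_comp; rec_auto.
have r3 : recfun X (fun x => y (p1 x)) by apply: rec_comp; rec_auto.
have r4 : recfun X (fun x => b (p1 x)) by apply: rec_comp; rec_auto.
have r11 : recfun X (fun x => e (p1 (p1 x))) by apply: (rec_comp r1); rec_auto.
have r12 : recfun X (fun x => n (p1 (p1 x))) by apply: (rec_comp r2); rec_auto.
rewrite /rule; repeat (apply: dec_if; first by rec_auto).
- by rec_auto.
- by rec_auto.
- by rec_auto.
- by rec_auto.
- by apply: cO; rec_auto.
- by apply: dec_and; apply: cG; rec_auto.
- apply: (dec_bex rb) => [|x k [/bd]] //.
  by apply: dec_and; apply: cG; rec_auto.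
- by apply: cG; rec_auto.
- apply: (dec_bex rb) => [|x k [/bd]] //.
  by apply: dec_and; apply: cG; rec_auto.
- apply: dec_and; first by apply: cG; rec_auto.
  apply: dec_ball => //.
  apply: (dec_bex r4) => [|x k /bd]; last exact: ltnW.
  by apply: cG; rec_auto.
Qed.

(** * Finite strings as partial oracles *)

(** A string is coded by the pair of its length and a code of its list of
    bits. *)
Definition bit (t i : nat) : bool := 0 < nthc (p2 t) i.

Definition prefix_of (t : nat) (W : real) : Prop :=
  forall i, i < p1 t -> bit t i = W i.

Definition properly_extends (s t : nat) : Prop :=
  p1 s < p1 t /\ forall i, i < p1 s -> bit s i = bit t i :> nat.

Lemma string_exists (W : real) l : exists t, p1 t = l /\ prefix_of t W.
Proof.
have [d hd] := nthc_surj (fun i => W i) l; exists (pr l d).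
rewrite /prefix_of /bit !prE; split=> // i il; rewrite hd //.
by case: (W i).
Qed.

Lemma prefix_properly_extends s t W :
  prefix_of s W -> prefix_of t W -> p1 s < p1 t -> properly_extends s t.
Proof.
by move=> sW tW st; split=> // i is_; rewrite sW // tW //; apply: ltn_trans st.
Qed.

Lemma rec_bit X f g :
  recfun X f -> recfun X g -> recfun X (fun n => bit (f n) (g n)).
Proof. by move=> rf rg; rewrite /bit; rec_auto. Qed.

(** The graph of [join B t], undefined where the string [t] is. *)
Definition finite_oracle (B : real) (t : nat) (q y : nat) : Prop :=
  if odd q then q./2 < p1 t /\ y = bit t q./2 else y = B q./2.

Lemma finite_oracle_total B t W q y : prefix_of t W ->
  finite_oracle B t q y -> total_oracle (join B W) q y.
Proof.
move=> tW; rewrite /finite_oracle /total_oracle /join.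
by case: ifP => // _ [lt ->]; rewrite tW.
Qed.

(** [w] codes the list, the length and the output of a computation of program
    [e] on input [e] with oracle [join B t]. *)
Definition converges_via (B : real) (e t w : nat) : Prop :=
  deriv (finite_oracle B t) (listc (p1 w) (p1 (p2 w))) /\
  triple e e (p2 (p2 w)) \in listc (p1 w) (p1 (p2 w)).

Lemma converges_viaP B e t :
  (exists w, converges_via B e t w) <->
  (exists y, derivable (finite_oracle B t) e e y).
Proof.
split=> [[w [h1 h2]]|[y [s [h1 h2]]]]; first by eexists; eexists; split; eassumption.
have [d hd] := listc_surj s; exists (pr d (pr (size s) y)).
by rewrite /converges_via !prE hd.
Qed.

Lemma dec_converges_via X B e t w :
  turing_le B X -> recfun X e -> recfun X t -> recfun X w ->
  dec X (fun x => converges_via B (e x) (t x) (w x)).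
Proof.
move=> /turing_leE BX re rt rw.
pose P x := converges_via B (p1 x) (p1 (p2 x)) (p2 (p2 x)).
suff dP : dec X P.
  apply: eq_dec (dec_comp dP (rec_pr re (rec_pr rt rw))) => x.
  by rewrite /P !prE.
rewrite /P /converges_via; apply: dec_and.
  apply: (eq_dec (fun x => iff_sym (deriv_listc _ _ _))).
  apply: dec_ball; first by rec_auto.
  apply: (dec_rule (b := fun x => (p1 (p2 (p2 (p1 x)))).+1)
    (O := fun x => finite_oracle B (p1 (p2 (p1 x))))
    (G := fun x e n y => exists j, (p2 x < j /\ j < p1 (p2 (p2 (p2 (p1 x))))) /\
       nthc (p1 (p2 (p2 (p1 x)))) j = triple e n y)); try by rec_auto.
  - rewrite /finite_oracle; apply: dec_if; first by rec_auto.
      by apply: dec_and; [rec_auto|apply: dec_eq; [rec_auto|apply: rec_bit; rec_auto]].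
    by apply: dec_eq; [rec_auto | apply: (rec_comp BX); rec_auto].
  - apply: dec_bex; last 1 first.
    + by move=> x k [[_ +] _]; exact.
    + by rec_auto.
    + by rewrite /triple; rec_auto.
  - move=> x e0 n y [j [_ E]]; rewrite ltnS.
    apply: leq_trans (nthc_leq _ j); rewrite E.
    by apply: leq_trans (leq_prr _ _); apply: leq_prr.
apply: (eq_dec (P := fun x => exists j, j < p1 (p2 (p2 (p2 x))) /\
  nthc (p1 (p2 (p2 x))) j = triple (p1 x) (p1 x) (p2 (p2 (p2 (p2 x)))))).
  move=> x; split=> [[j [jm <-]]|/mapP[j]].
    by apply: map_f; rewrite mem_iota.
  by rewrite mem_iota => jm ->; exists j.
apply: dec_bex; last 1 first.
- by move=> x k [+ _]; exact.
- by rec_auto.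
- by rewrite /triple; rec_auto.
Qed.

(** The question asked during the construction of the generic real: can the
    string [s] be extended so as to make program [e] converge on input [e]?
    Here [k] is the pair of the extension and of a computation. *)
Definition force (B : real) (e s : nat) : Prop :=
  exists k, properly_extends s (p1 k) /\ converges_via B e (p1 k) (p2 k).

Definition halts (X : real) (c : code) (n : nat) : Prop := exists y, eval X c n y.

Lemma converges_via_halts B c t w W :
  converges_via B (encode c) t w -> prefix_of t W -> halts (join B W) c (encode c).
Proof.
move=> hw tW; have /converges_viaP[y hy] : exists w, converges_via B (encode c) t w by exists w.
exists y; apply: derivable_eval; apply: derivable_mono hy => q z.
exact: finite_oracle_total.
Qed.

(** By the use principle a computation with oracle [join B W] only depends on
    a finite part of [W]. *)
Lemma halts_force B c s W :
  prefix_of s W -> halts (join B W) c (encode c) -> force B (encode c) s.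
Proof.
move=> sW [y /eval_derivable[l [/deriv_use[u hu] hl]]].
have [t [lt tW]] := string_exists W (maxn u (p1 s).+1).
have [w hw] : exists w, converges_via B (encode c) t w.
  apply/converges_viaP; exists y, l; split=> //; apply: deriv_mono hu => q z [qu ->].
  rewrite /finite_oracle /join; case: (odd q) => //.
  suff qt : q./2 < p1 t by rewrite tW.
  rewrite lt leq_max; apply/orP; left; apply: leq_ltn_trans qu.
  by rewrite -{2}(odd_double_half q) -addnn addnA leq_addl.
exists (pr t w); rewrite !prE; split=> //; apply: prefix_properly_extends tW _ => //.
by rewrite lt leq_max ltnSn orbT.
Qed.

(** * Deciding Sigma_1 questions with the jump *)

Lemma rec_encode_const X : recfun X (fun k => encode (const_code k)).
Proof.
apply: (@eq_recfun _ (fun k => nat_rect (fun=> nat) (pr 0 0)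
   (fun _ z => pr 6 (pr (pr 1 0) z)) k)).
  by elim=> [|k /= ->].
by apply: rec_natrec; rec_auto.
Qed.

(** The jump only answers questions about a program run on its own number, so
    the argument [n] is first built into a program, which then ignores its
    input. *)
Lemma jump_dec_ex B A (P : nat -> nat -> Prop) :
  turing_le (jump B) A -> dec B (fun n => P (p1 n) (p2 n)) ->
  dec A (fun n => exists k, P n k).
Proof.
move=> JA /dec_search[c hc].
pose f n := encode (Comp c (const_code n)).
have rf : recfun A f.
  apply: (@eq_recfun _ (fun n => pr 6 (pr (encode c) (encode (const_code n))))).
    by [].
  by have rk := rec_encode_const A; rec_auto.
apply: (eq_dec (P := fun n => nat_of_bool (jump B (f n)) = 1)); last first.
  by apply: dec_eq; [move/turing_leE: JA => /rec_comp; apply | rec_auto].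
move=> n; rewrite -hc /jump; case: asboolP => h; split=> //.
- move=> _; case: h => y [d [/encode_inj ->]] /= [a [ha hy]].
  by exists y; rewrite (eval_fun (eval_const B n _) ha).
- move=> [y hy]; case: h; exists y, (Comp c (const_code n)); split=> //=.
  by exists n; split=> //; apply: eval_const.
Qed.

Lemma turing_le_jump B : turing_le B (jump B).
Proof.
apply/turing_leE/rec_bool.
apply: (eq_dec (P := fun n => exists k, B n /\ k = 0)).
  by move=> n; split=> [[k []]|] //; exists 0.
apply: (jump_dec_ex (turing_le_refl _)) => //.
by apply: dec_and; [apply: dec_oracle; rec_auto|rec_auto].
Qed.

(** No real decides its own halting problem.  Only genuine program numbers
    count, so this applies to predicates that differ from the jump at numbers
    which code no program. *)
Lemma diagonal X (P : nat -> Prop) :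
  dec X P -> exists c, ~ (P (encode c) <-> halts X c (encode c)).
Proof.
move=> dP.
have [c hc] : exists c, forall n, halts X c n <-> exists k, ~ P n /\ k = 0.
  apply: dec_search; apply: dec_and; last by rec_auto.
  by apply: dec_not; apply: (dec_comp dP); rec_auto.
exists c; rewrite hc => h.
have nP : ~ P (encode c) by move=> Pc; have [k []] := h.1 Pc.
by apply: (nP); apply/h; exists 0.
Qed.

Lemma dec_properly_extends X f g :
  recfun X f -> recfun X g -> dec X (fun x => properly_extends (f x) (g x)).
Proof.
move=> rf rg; rewrite /properly_extends; apply: dec_and; first by rec_auto.
apply: dec_ball; first by rec_auto.
have r1 : recfun X (fun x => f (p1 x)) by apply: rec_comp; rec_auto.
have r2 : recfun X (fun x => g (p1 x)) by apply: rec_comp; rec_auto.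
by apply: dec_eq; apply: rec_bit; rec_auto.
Qed.

Lemma dec_force B A e s : turing_le (jump B) A -> recfun A e -> recfun A s ->
  dec A (fun x => force B (e x) (s x)).
Proof.
move=> JA re rs.
suff d : dec A (fun x => force B (p1 x) (p2 x)).
  by apply: eq_dec (dec_comp d (rec_pr re rs)) => x; rewrite !prE.
apply: (jump_dec_ex JA); apply: dec_and; first by apply: dec_properly_extends; rec_auto.
by apply: dec_converges_via; rec_auto; apply: turing_le_refl.
Qed.

(** * A generic real below A *)

Section Generic.
Variables (A : real) (K : nat) (B : nat -> real).
Hypothesis JA : forall i, i < K -> turing_le (jump (B i)) A.

(** The number [x] is the pair of a stage and of the string built before it; the
    stage is itself the pair of a program number and of an index [i < K].
    The number [k] is the pair of the next string and of a computation. *)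
Definition good_step (x k : nat) : Prop :=
  properly_extends (p2 x) (p1 k) /\
  forall i, i < K -> p2 (p1 x) = i -> force (B i) (p1 (p1 x)) (p2 x) ->
    converges_via (B i) (p1 (p1 x)) (p1 k) (p2 k).

Lemma good_step_ex x : exists k, good_step x k.
Proof.
have longer : exists t, properly_extends (p2 x) t.
  pose W i := bit (p2 x) i.
  have [t [lt tW]] := string_exists W (p1 (p2 x)).+1.
  by exists t; apply: (@prefix_properly_extends _ _ W) => //; rewrite lt.
case: (pselect (exists2 i, i < K & p2 (p1 x) = i /\ force (B i) (p1 (p1 x)) (p2 x))).
  move=> [i iK [ei [k [ek hk]]]]; exists k; split=> // j jK.
  by rewrite ei => <-.
move=> h; have [t ht] := longer; exists (pr t 0).
rewrite /good_step prE; split=> // i iK ei hf; case: h; by exists i.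
Qed.

Lemma dec_good_step : dec A (fun n => good_step (p1 n) (p2 n)).
Proof.
apply: dec_and; first by apply: dec_properly_extends; rec_auto.
apply: dec_ball_fin => i /JA JAi.
apply: dec_imp; first by rec_auto.
apply: dec_imp; first by apply: dec_force; rec_auto.
apply: dec_converges_via; rec_auto.
exact: turing_le_trans (turing_le_jump _) JAi.
Qed.

Lemma stages_exist : exists2 s : nat -> nat, recfun A s &
  forall t, exists w, good_step (pr t (s t)) (pr (s t.+1) w).
Proof.
have [f rf hf] := rec_choice good_step_ex dec_good_step.
pose s t := nat_rect (fun=> nat) (pr 0 0) (fun t z => p1 (f (pr t z))) t.
exists s.
  apply: rec_natrec; [by rec_auto|by rec_auto|].
  by apply: rec_p1; apply: (rec_comp rf); rec_auto.
by move=> t; exists (p2 (f (pr t (s t)))); rewrite /= pr_p; apply: hf.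
Qed.

(** Here [g i e] is the string at the beginning of the stage of program [e] and
    index [i]: whether it can be extended to force convergence determines
    whether convergence is forced by [Z]. *)
Lemma generic_exists : exists2 Z : real, turing_le Z A &
  exists2 g : nat -> nat -> nat, (forall i, recfun A (g i)) &
  forall i e, i < K -> prefix_of (g i e) Z /\
    (force (B i) e (g i e) -> exists t w, prefix_of t Z /\ converges_via (B i) e t w).
Proof.
have [s rs hs] := stages_exist.
have ext_s t : properly_extends (s t) (s t.+1) by have [w []] := hs t; rewrite !prE.
have len_s t : t <= p1 (s t).
  by elim: t => // t IH; apply: leq_ltn_trans IH _; case: (ext_s t).
(* The string at stage n + 1 has length greater than n. *)
pose Z : real := fun n => bit (s n.+1) n.
have sub_s t n i : i < p1 (s t) -> bit (s t) i = bit (s (n + t)) i.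
  move=> it; elim: n => [|n ->] //.
  have lt : i < p1 (s (n + t)).
    by elim: n => // n IH; apply: ltn_trans IH _; case: (ext_s (n + t)).
  by case: (ext_s (n + t)) => _ /(_ i lt); rewrite addSn; case: bit; case: bit.
have sZ t : prefix_of (s t) Z.
  move=> i it; rewrite /Z; case: (leqP t i.+1) => [le|lt].
    by rewrite (sub_s _ (i.+1 - t)) // subnK.
  by rewrite (sub_s i.+1 (t - i.+1)) ?subnK ?len_s // ltnW.
exists Z.
  apply/turing_leE; apply: rec_bit; last by rec_auto.
  by apply: (rec_comp rs); rec_auto.
exists (fun i e => s (pr e i)); first by move=> i; apply: (rec_comp rs); rec_auto.
move=> i e iK; split=> // hf.
have [w [_]] := hs (pr e i); rewrite !prE => /(_ i iK erefl hf) hw.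
by exists (s (pr e i).+1), w.
Qed.

End Generic.

(** The program must not depend on [W], so it has to be written down
    explicitly around programs that ignore their oracle. *)
Lemma separating_code (Z : real) : computable Z ->
  exists c, forall B W n, halts (join B W) c n <-> exists k, W k <> Z k.
Proof.
move=> /turing_leE rZ.
have rZ2 : recfun empty_real (fun x => Z (p2 x)) by apply: (rec_comp rZ); rec_auto.
have [cz hz] := uniform_recfun rZ2.
have [co ho] : exists c, forall X n, eval X c n (p2 n + p2 n).+1.
  by apply: uniform_recfun; rec_auto.
have [ce he] : exists c, forall X n, eval X c n (p1 n == p2 n).
  by apply: uniform_recfun; rec_auto.
pose c := Comp ce (Pair (Comp Oracle co) cz).
have hc B W x : eval (join B W) c x (W (p2 x) == Z (p2 x)).
  exists (pr (W (p2 x)) (Z (p2 x))); split.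
    exists (W (p2 x)), (Z (p2 x)); split=> //.
    eexists; split; first exact: ho.
    rewrite /= /join /= oddD addbb /= addnn uphalf_half odd_double /=.
    by rewrite doubleK.
  have := he (join B W) (pr (W (p2 x)) (Z (p2 x))); rewrite !prE.
  by rewrite (_ : (nat_of_bool _ == _) = (W (p2 x) == Z (p2 x))) //; do 2 case: (_ (p2 x)).
exists (Mu c) => B W n; split=> [[y [hy _]]|[k hk]].
  exists y => E; have := eval_fun (hc B W _) hy.
  by rewrite /pr -/(pr n y) p2_pr E eqxx.
have ex : exists j, W j != Z j by exists k; apply/eqP.
exists (ex_minn ex); case: ex_minnP => j hj jmin /=; split.
  by have := hc B W (pr n j); rewrite p2_pr (negbTE hj).
move=> i ij; exists 0.
have := hc B W (pr n i); rewrite p2_pr; case: eqP => // /eqP /jmin.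
by rewrite leqNgt ij.
Qed.

(** The two consequences of genericity: no [join (B i) Z] computes [A],
    because otherwise it would decide its own halting problem; and [Z] differs
    from every computable real, because every string can be extended so as to
    leave that real. *)
Lemma avoid_cones (A : real) K (B : nat -> real) : 0 < K ->
  (forall i, i < K -> turing_le (jump (B i)) A) ->
  exists Z, [/\ turing_le Z A, ~ computable Z &
    forall i, i < K -> ~ turing_le A (join (B i) Z)].
Proof.
move=> K0 JA; have [Z ZA [g rg hg]] := generic_exists JA.
have decide i c : i < K ->
    force (B i) (encode c) (g i (encode c)) <->
    halts (join (B i) Z) c (encode c).
  move=> iK; have [gZ h] := hg i (encode c) iK; split.
    by move=> /h[t [w [tZ hw]]]; apply: converges_via_halts hw tZ.
  exact: halts_force gZ.
exists Z; split=> //.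
- move=> /separating_code[c hc].
  have [gZ _] := hg 0 (encode c) K0; set t := g _ _ in gZ.
  (* W agrees with Z on the string t and leaves Z right after it. *)
  pose W i := if i == p1 t then ~~ Z i else Z i.
  have tW : prefix_of t W.
    by move=> i it; rewrite /W ltn_eqF // gZ.
  have : force (B 0) (encode c) t.
    apply: halts_force tW _; apply/hc; exists (p1 t).
    by rewrite /W eqxx; case: (Z _).
  by move=> /(decide _ _ K0) /hc[k].
- move=> i iK AZ.
  have d : dec (join (B i) Z) (fun e => force (B i) e (g i e)).
    apply: dec_trans AZ _; apply: dec_force; [exact: JA|by rec_auto|exact: rg].
  by have [c] := diagonal d; apply; apply: decide.
Qed.

(** * Counting degrees *)

Lemma countable_degrees (A : real) (F : set (set real)) :
  (forall D, F D -> exists2 B, D = deg B & turing_le B A) -> countable F.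
Proof.
move=> hF.
have /choice[ix hix] : forall D, exists e, F D ->
    exists2 B, D = deg B & forall n, phi A e n (B n).
  move=> D; case: (pselect (F D)) => [/hF[B DB [e he]]|nF]; last by exists 0.
  by exists e => _; exists B.
apply/countable_injP; exists ix => D D' /set_mem FD /set_mem FD' E.
have [B DB hB] := hix _ FD; have [B' DB' hB'] := hix _ FD'.
rewrite DB DB'; congr deg; apply/funext => n.
have [c [ec hc]] := hB n; have [c' [ec' hc']] := hB' n.
have cc : c = c' by apply: encode_inj; rewrite ec ec' E.
move: hc'; rewrite -cc => /(eval_fun hc).
by case: (B n); case: (B' n).
Qed.

(** If the degrees were those of finitely many reals [B i], the Join Property
    applied to a [Z] given by [avoid_cones] would yield a [C] equivalent to
    some [B i] with [A <= C + Z]. *)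
Lemma jump_degrees_infinite (R : set real) (A : real) :
  join_property R -> turing_le (jump empty_real) A ->
  infinite_set (jump_degrees R A).
Proof.
move=> hR hA [K /card_esym /card_set_bijP[D [Dfun _ Dsurj]]].
have /choice[B hB] : forall i, exists B, turing_le (jump B) A /\
    (i < K -> D i = deg B).
  move=> i; case: (ltnP i K) => [iK|_]; last by exists empty_real.
  have [B [_ [JB _] [BA _]] DB] := Dfun i iK.
  by exists B; split=> //; apply: turing_le_trans BA.
(* The empty real is added so that the family of oracles is nonempty. *)
pose Bs i := if i is j.+1 then B j else empty_real.
have [Z [ZA nZ hZ]] : exists Z, [/\ turing_le Z A, ~ computable Z &
    forall i, i < K.+1 -> ~ turing_le A (join (Bs i) Z)].
  by apply: avoid_cones => // -[|i] _ //=; have [] := hB i.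
have [C [RC [AC CA] [CO OC] [h1 h2]]] := hR A Z (join_lub ZA hA) nZ.
have : jump_degrees R A (deg C).
  exists C => //; split=> //; split; first exact: turing_le_trans OC CA.
  exact: turing_le_trans AC CO.
move=> /Dsurj[i iK DC].
have [_ /(_ iK) DB] := hB i.
have [CB _] : turing_equiv C (B i).
  have : deg C C by split; apply: turing_le_refl.
  by rewrite -DC DB.
apply: (hZ i.+1) => //=.
apply: turing_le_trans AC _; apply: turing_le_trans CO _.
apply: turing_le_trans h1 _; apply: join_lub; last exact: join_ubr.
exact: turing_le_trans CB (join_ubl _ _).
Qed.

Theorem propositionA2 (R : set real) (hR : join_property R)
    (A : real) (hA : turing_le (jump empty_real) A) :
  jump_degrees R A #= [set: nat].
Proof.
rewrite card_eq_le; apply/andP; split; last first.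
  exact/infiniteP/jump_degrees_infinite.
apply: (@countable_degrees A) => D [B [_ _ [BA _]] <-].
by exists B => //; apply: turing_le_trans (join_ubl _ _) BA.
Qed.
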